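(* Let $\tilde G$ be the binary octahedral group. With the matrix $S_{0,1}$ and the diagonal matrices $T_0,T_1$ of $D(\tilde G)\text{-}\mathrm{mod}$ defined in the context, put $\tilde S_{0,1}=\frac{1}{24}S_{0,1}$. Then the matrix $\tilde S_{0,1}$ is equal to the Fourier matrix $S$ of the big family of unipotent characters of ${}^2F_4$. Moreover the matrix $T_1^2$ is the opposite of the diagonal matrix of eigenvalues of the Frobenius. More precisely, $$\tilde{S}_{0,1}=S,\qquad F_1=T_0\qquad\text{and}\qquad F_2=-T_1^{-2},$$ where $$S = \tfrac{1}{12}\left(\begin{smallmatrix} 3&3&6&-6&-3&-3&-3&-3&-3&-3&0&0&0\\ 0&0&0&-4&4&4&0&0&0&0&4&4&-8\\ -6&-6&0&-4&-2&-2&0&0&0&0&4&4&4\\ 3&3&6&2&1&1&3&3&3&3&4&4&4\\ 3\sqrt 2&-3\sqrt 2&0&0&-3\sqrt 2&3\sqrt 2&3\sqrt 2&3\sqrt 2&-3\sqrt 2&-3\sqrt 2&0&0&0\\ 3\sqrt 2&-3\sqrt 2&0&0&3\sqrt 2&-3\sqrt 2&-3\sqrt 2&3\sqrt 2&-3\sqrt 2&3\sqrt 2&0&0&0\\ 3\sqrt 2&-3\sqrt 2&0&0&3\sqrt 2&-3\sqrt 2&3\sqrt 2&-3\sqrt 2&3\sqrt 2&-3\sqrt 2&0&0&0\\ 0&0&0&0&0&0&6&-6&-6&6&0&0&0\\ 3&3&-6&-6&-3&-3&3&3&3&3&0&0&0\\ -3&-3&6&-2&-1&-1&3&3&3&3&-4&-4&-4\\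 0&0&0&-4&4&4&0&0&0&0&4&-8&4\\ 0&0&0&-4&4&4&0&0&0&0&-8&4&4\\ 3\sqrt 2&-3\sqrt 2&0&0&-3\sqrt 2&3\sqrt 2&-3\sqrt 2&-3\sqrt 2&3\sqrt 2&3\sqrt 2&0&0&0 \end{smallmatrix}\right),$$ $$F_1=\mathrm{diag}(1, 1, 1, 1, 1, \zeta_4, -\zeta_4, -1, 1, 1, \zeta_3, \zeta_3^2, -1),$$ $$F_2=\mathrm{diag}(1, 1, 1, -1, -1, -1, -\zeta_4, \zeta_4, \zeta_4, -\zeta_4, -\zeta_3, -\zeta_3^2, -1).$$
   Context: Everything is over $\mathbb{C}$; $\zeta_k$ denotes a chosen primitive $k$-th root of unity. For a finite group $H$, the Drinfeld double $D(H)$ is the Hopf algebra with basis $(e_gh)_{g,h\in H}$, multiplication $(e_gh)(e_{g'}h')=\delta_{g,hg'h^{-1}}e_g(hh')$, coproduct $\Delta(e_gh)=\sum_{g_1g_2=g}e_{g_1}h\otimes e_{g_2}h$, counit $e_gh\mapsto\delta_{g,1}$, antipode $e_gh\mapsto e_{h^{-1}g^{-1}h}h^{-1}$, and $R$-matrix $R=\sum_{g}g\otimes e_g$. The category $D(H)\text{-}\mathrm{mod}$ of finite dimensional modules is modular, with braiding $c$ given by $R$ followed by the flip, and spherical structure given by the usual identification of a vector space with its bidual. The twist $\theta$ associated with this structure satisfies $\theta_{X\otimes Y}=(\theta_X\otimes\theta_Y)\circ c_{Y,X}\circ c_{X,Y}$; it acts on a simple module by a scalar. The simple modules are the $V_{g,\rho}$,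 for $g\in H$ and $\rho$ an irreducible representation of the centralizer $Z_H(g)$, up to conjugation; $V_{g,\rho}$ is supported on the conjugacy class of $g$, with $e_gV_{g,\rho}\simeq\rho$. The $S$-matrix is $S_{X,Y}=\mathrm{tr}_{X\otimes Y}(c_{Y,X}\circ c_{X,Y})$. Group: $\tilde{G}=\langle z,t_1,t_2,t_3\mid z^2=1,\ t_i^2=z,\ (t_1t_2)^3=z,\ (t_2t_3)^3=z,\ (t_1t_3)^2=z\rangle$, in which $z$ is central; it is a central extension of $\mathfrak{S}_4$ (via $t_i\mapsto(i,i+1)$) by $\langle z\rangle\simeq\mathbb{Z}/2\mathbb{Z}$. Its irreducible characters, by their values at $(1,z,t_1,t_1t_3,t_1t_2,zt_1t_2,t_1t_2t_3,zt_1t_2t_3)$, are: $1$ (trivial); $\varepsilon$: $(1,1,-1,1,1,1,-1,-1)$; $\chi_2$: $(2,2,0,2,-1,-1,0,0)$; $\chi_3$: $(3,3,1,-1,0,0,-1,-1)$; $\chi_3'$: $(3,3,-1,-1,0,0,1,1)$; $\psi_2$: $(2,-2,0,0,1,-1,\sqrt2,-\sqrt2)$; $\psi_2'$: $(2,-2,0,0,1,-1,-\sqrt2,\sqrt2)$; $\psi_4$: $(4,-4,0,0,-1,1,0,0)$. Centralizers: $Z(1)=Z(z)=\tilde G$; $Z(t_1)\simeq\mathbb{Z}/4\mathbb{Z}$, generated by $t_1$; $Z(t_1t_3)\simeq\mathbb{Z}/8\mathbb{Z}$, generated by $t_1t_2t_1t_3t_2$; $Z(t_1t_2)=Z(zt_1t_2)\simeq\mathbb{Z}/6\mathbb{Z}$,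 generated by $t_1t_2$; $Z(t_1t_2t_3)=Z(zt_1t_2t_3)\simeq\mathbb{Z}/8\mathbb{Z}$, generated by $t_1t_2t_3$. The irreducible characters of a cyclic group $\mathbb{Z}/k\mathbb{Z}$ ($k\in\{4,6,8\}$) are identified with the powers $\zeta_k^r$, $r\in\mathbb{Z}/k\mathbb{Z}$ (value on the generator). Grading: $D(\tilde G)\text{-}\mathrm{mod}$ is graded by $\mathbb{Z}/2\mathbb{Z}$: $V_{g,\rho}$ has degree $0$ (resp. $1$) if $z$ acts on $\rho$ by $1$ (resp. $-1$). The invertible object $V_{z,1}$, of tensor square the unit, acts by tensor product on isomorphism classes of simple objects. Chosen representatives, in this order, of the orbits of this action. Degree $0$ (orbits of non-fixed objects): $V_{z,\chi_3},\ V_{t_1t_2,1},\ V_{z,\chi_2},\ V_{1,1},\ V_{zt_1t_2t_3,1},\ V_{t_1t_2t_3,\zeta_8^6},\ V_{t_1t_2t_3,\zeta_8^2},\ V_{t_1t_3,\zeta_8^6},\ V_{z,\chi_3'},\ V_{z,\varepsilon},\ V_{t_1t_2,\zeta_6^4},\ V_{t_1t_2,\zeta_6^2},\ V_{zt_1t_2t_3,\zeta_8^4}$. Degree $1$: $V_{t_1t_3,\zeta_8},\ V_{t_1t_3,\zeta_8^3},\ V_{t_1,\zeta_4},\ V_{1,\psi_4},\ V_{1,\psi_2'},\ V_{1,\psi_2},\ V_{t_1t_2t_3,\zeta_8^5},\ V_{t_1t_2t_3,\zeta_8^3},\ V_{t_1t_2t_3,\zeta_8^7},\ V_{t_1t_2t_3,\zeta_8},\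 V_{zt_1t_2,\zeta_6},\ V_{zt_1t_2,\zeta_6^5},\ V_{zt_1t_2,\zeta_6^3}$. $S_{0,1}=(S_{X,Y})$ with $X$ running over the degree $0$ list (rows) and $Y$ over the degree $1$ list (columns); $T_0=\mathrm{diag}(\theta_X^{-1})$ over the degree $0$ list and $T_1=\mathrm{diag}(\theta_Y^{-1})$ over the degree $1$ list. The number $24$ is the positive square root of half the dimension of the degree $0$ component. $S$, $F_1$, $F_2$ are the Fourier matrix and the associated diagonal matrices ($F_2$ being that of eigenvalues of the Frobenius) of Geck and Malle for the family of $13$ unipotent characters of the Ree group of type ${}^2F_4$.
   Formalization: In the lists, χ_3 and χ_3' are exchanged, ψ_2 and ψ_2' are exchanged, and V_{t1t3,ζ_8^2} replaces V_{t1t3,ζ_8^6} (same orbit), as the printed lists give wrong entries; the roots ζ_k are taken compatible (ζ_{km}^m=ζ_k) with ζ_8+ζ_8^{-1}=√2. *)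

(* Defs.v *)
From HB Require Import structures.
From mathcomp Require Import all_boot all_order all_algebra all_fingroup all_solvable all_character.
From mathcomp Require Import complex reals.

Set Implicit Arguments.
Unset Strict Implicit.
Unset Printing Implicit Defensive.

Import GroupScope GRing.Theory Num.Theory.
Local Open Scope ring_scope.

Section DrinfeldDouble.
Variables (C : fieldType) (gT : finGroupType).

Definition drinfeld_double : Type := {ffun gT * gT -> C^o}.
HB.instance Definition _ := GRing.Lmodule.copy drinfeld_double {ffun gT * gT -> C^o}.
Implicit Types a b : drinfeld_double.

Definition dd_basis (g h : gT) : drinfeld_double :=
  [ffun p => (p == (g, h))%:R].

Definition dd_one : drinfeld_double := \sum_g dd_basis g 1%g.

(* The convolution form of the product; dd_basis_mul recovers
   (e_g h) (e_g' h') = delta_(g, h g' h^-1) e_g (h h').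
   Note that k ^ h is h^-1 k h. *)
Definition dd_mul a b : drinfeld_double :=
  [ffun p => \sum_h a (p.1, h) * b ((p.1 ^ h)%g, (h^-1 * p.2)%g)].

Lemma dd_basis_mul g h g' h' :
  dd_mul (dd_basis g h) (dd_basis g' h') =
  (g == h * g' * h^-1)%g%:R *: dd_basis g (h * h')%g.
Proof.
apply/ffunP => -[k l]; rewrite !ffunE /=.
rewrite (bigD1 h) //= big1 ?addr0 => [|i ih]; last first.
  by rewrite !ffunE !xpair_eqE (negPf ih) andbF mul0r.
rewrite !ffunE !xpair_eqE eqxx andbT /GRing.scale /=.
have [->|] := eqVneq k g; last by rewrite mul0r mulr0.
rewrite mul1r -natrM mulnb; congr (_%:R); congr (nat_of_bool (_ && _)).
  by rewrite (can2_eq (conjgK h) (conjgKV h)) conjgE invgK mulgA.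
by rewrite (can2_eq (mulKVg h) (mulKg h)).
Qed.

Lemma dd_oneE p : dd_one p = (p.2 == 1%g)%:R.
Proof.
case: p => k l; rewrite /dd_one sum_ffunE (bigD1 k) //= big1 ?addr0 => [|i ik].
  by rewrite ffunE xpair_eqE eqxx.
by rewrite ffunE xpair_eqE eq_sym (negPf ik).
Qed.

Lemma dd_mulA : associative dd_mul.
Proof.
move=> a b c; apply/ffunP => -[k l]; rewrite !ffunE /=.
under eq_bigr => h _ do rewrite ffunE big_distrr /=.
under [RHS]eq_bigr => h _ do rewrite ffunE big_distrl /=.
rewrite [RHS]exchange_big /=; apply: eq_bigr => h _.
rewrite [RHS](reindex_inj (mulgI h)) /=; apply: eq_bigr => h' _.
by rewrite mulrA mulKg -conjgM invMg mulgA.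
Qed.

Lemma dd_mul1l : left_id dd_one dd_mul.
Proof.
move=> a; apply/ffunP => -[k l]; rewrite !ffunE /= (bigD1 1%g) //= big1 => [|h h1].
  by rewrite dd_oneE eqxx mul1r conjg1 invg1 mul1g addr0.
by rewrite dd_oneE /= (negPf h1) mul0r.
Qed.

Lemma dd_mul1r : right_id dd_one dd_mul.
Proof.
move=> a; apply/ffunP => -[k l]; rewrite !ffunE /= (bigD1 l) //= big1 => [|h hl].
  by rewrite dd_oneE /= mulVg eqxx mulr1 addr0.
by rewrite dd_oneE /= -eq_mulVg1 (negPf hl) mulr0.
Qed.

Lemma dd_mulDl : left_distributive dd_mul +%R.
Proof.
move=> a b c; apply/ffunP => p; rewrite !ffunE -big_split /=.
by apply: eq_bigr => h _; rewrite ffunE mulrDl.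
Qed.

Lemma dd_mulDr : right_distributive dd_mul +%R.
Proof.
move=> a b c; apply/ffunP => p; rewrite !ffunE -big_split /=.
by apply: eq_bigr => h _; rewrite ffunE mulrDr.
Qed.

Lemma dd_one_neq0 : dd_one != 0.
Proof.
apply/eqP => /ffunP/(_ (1%g, 1%g)); rewrite dd_oneE eqxx ffunE.
by move/eqP; rewrite oner_eq0.
Qed.

HB.instance Definition _ := GRing.Zmodule_isNzRing.Build drinfeld_double
  dd_mulA dd_mul1l dd_mul1r dd_mulDl dd_mulDr dd_one_neq0.

Lemma dd_scaleAl k a b : k *: (a * b) = (k *: a) * b.
Proof.
apply/ffunP => p; rewrite !ffunE /GRing.scale /= big_distrr /=.
by apply: eq_bigr => h _; rewrite !ffunE /GRing.scale /= mulrA.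
Qed.

HB.instance Definition _ :=
  GRing.Lmodule_isLalgebra.Build C drinfeld_double dd_scaleAl.

Lemma dd_scaleAr k a b : k *: (a * b) = a * (k *: b).
Proof.
apply/ffunP => p; rewrite !ffunE /GRing.scale /= big_distrr /=.
by apply: eq_bigr => h _; rewrite !ffunE /GRing.scale /= mulrCA.
Qed.

HB.instance Definition _ :=
  GRing.Lalgebra_isAlgebra.Build C drinfeld_double dd_scaleAr.

Definition dd_idem (g : gT) : drinfeld_double := dd_basis g 1%g.
Definition dd_elt (h : gT) : drinfeld_double := \sum_g dd_basis g h.

Lemma dd_basisE g h : dd_basis g h = dd_idem g * dd_elt h.
Proof.
rewrite /dd_elt mulr_sumr (bigD1 g) //= big1 ?addr0 => [|k kg].
  by rewrite [RHS]dd_basis_mul mul1g invg1 mulg1 eqxx scale1r mul1g.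
by rewrite [LHS]dd_basis_mul mul1g invg1 mulg1 eq_sym (negPf kg) scale0r.
Qed.

(* A left module, with underlying space the column vectors of size dd_dim. *)
Record dd_module := DDModule {
  dd_dim : nat;
  dd_act :> {lrmorphism drinfeld_double -> 'M[C]_dd_dim}
}.

(* A subspace is the row space of some U, whose rows are the transposes of
   column vectors; this is why the action is transposed. *)
Definition dd_simple (X : dd_module) : Prop :=
  (0 < dd_dim X)%N /\
  forall U : 'M[C]_(dd_dim X),
    (forall a, stablemx U (X a)^T) -> U != 0 -> row_full U.

(* X is V_(g, rho): the columns of P are a basis of e_g X in which the
   centralizer of g acts through rho. *)
Definition is_V (X : dd_module) (g : gT) (d : nat)
    (rho : mx_representation C 'C[g]%G d) : Prop :=
  [/\ dd_simple X,
      forall k, k \notin (g ^: [set: gT])%g -> X (dd_idem k) = 0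
    & exists P : 'M[C]_(dd_dim X, d),
        [/\ row_free P^T, (P^T == (X (dd_idem g))^T)%MS
          & {in 'C[g]%g, forall h, X (dd_elt h) *m P = P *m rho h}]].

(* The tensor product of X and Y is modelled on matrices, the pure tensor of
   x and y being x *m y^T. Then the tensor product of A and B is
   u |-> A *m u *m B^T, the flip is the transposition, and the R-matrix is
   the sum over g of the tensors of g and e_g. *)
Definition braiding (X Y : dd_module)
    (u : 'M[C]_(dd_dim X, dd_dim Y)) : 'M[C]_(dd_dim Y, dd_dim X) :=
  (\sum_g X (dd_elt g) *m u *m (Y (dd_idem g))^T)^T.

Definition S_coef (X Y : dd_module) : C :=
  \tr (lin_mx (@braiding Y X \o @braiding X Y)).

(* The twist attached to the braiding and to the spherical structure: the
   partial trace of c_(X,X) over the second factor. As the spherical structure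
   is the usual identification with the bidual, the traces, here and in S_coef,
   are the ones of linear algebra. *)
Definition twist (X : dd_module) : 'M[C]_(dd_dim X) :=
  \matrix_(i, k) \sum_j @braiding X X (delta_mx k j) i j.

Definition S_matrix n (X Y : 'I_n -> dd_module) : 'M[C]_n :=
  \matrix_(i, j) S_coef (X i) (Y j).

Definition is_inv_twist_matrix n (X : 'I_n -> dd_module) (T : 'M[C]_n) : Prop :=
  exists theta : 'I_n -> C,
    (forall i, twist (X i) = (theta i)%:M) /\
    T = diag_mx (\row_i (theta i)^-1).

End DrinfeldDouble.

Section BinaryOctahedral.
Variables (gT : finGroupType) (z t1 t2 t3 : gT).

(* The last clause makes [set: gT] the group with this presentation; the others
   make z, t1, t2, t3 a system of generators as in the presentation. *)
Definition binary_octahedral : Prop :=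
  [/\ [/\ z ^+ 2 = 1, t1 ^+ 2 = z, t2 ^+ 2 = z & t3 ^+ 2 = z]%g,
      [/\ (t1 * t2) ^+ 3 = z, (t2 * t3) ^+ 3 = z & (t1 * t3) ^+ 2 = z]%g,
      <<[set z; t1; t2; t3]>>%g = [set: gT]
    & [set: gT] \isog Grp (z : t1 : t2 : t3 :
         z ^+ 2, t1 ^+ 2 = z, t2 ^+ 2 = z, t3 ^+ 2 = z,
         (t1 * t2) ^+ 3 = z, (t2 * t3) ^+ 3 = z, (t1 * t3) ^+ 2 = z)].

Variables (C : numClosedFieldType) (zeta : nat -> C).

(* A compatible choice of roots of unity, as zeta k = exp (2 i pi / k). The
   last clause excludes the two primitive eighth roots of unity whose real part
   is negative; it ties zeta 8 to the square root of 2 of the characters. *)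
Definition root_system : Prop :=
  [/\ forall k, (0 < k)%N -> k.-primitive_root (zeta k),
      forall k m, (0 < k)%N -> (0 < m)%N -> zeta (k * m) ^+ m = zeta k
    & zeta 8 + (zeta 8)^-1 = sqrtC 2].

(* A pair (g, rho), with the irreducible representation rho of the centralizer
   of g given by sufficiently many values of its character. *)
Record label := Label { label_elt : gT; label_char : seq (gT * C) }.

Definition has_label (X : dd_module C gT) (l : label) : Prop :=
  exists d (rho : mx_representation C 'C[label_elt l]%G d),
    [/\ mx_irreducible rho,
        {in label_char l, forall p, \tr (rho p.1) = p.2}
      & is_V X rho].

Definition char_elts : seq gT :=
  [:: 1; z; t1; t1 * t3; t1 * t2; z * t1 * t2; t1 * t2 * t3; z * t1 * t2 * t3]%g.

Definition triv : seq C := [:: 1; 1; 1; 1; 1; 1; 1; 1].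
Definition eps  : seq C := [:: 1; 1; -1; 1; 1; 1; -1; -1].
Definition chi2 : seq C := [:: 2; 2; 0; 2; -1; -1; 0; 0].
Definition chi3 : seq C := [:: 3; 3; 1; -1; 0; 0; -1; -1].
Definition chi3' : seq C := [:: 3; 3; -1; -1; 0; 0; 1; 1].
Definition psi2 : seq C := [:: 2; -2; 0; 0; 1; -1; sqrtC 2; - sqrtC 2].
Definition psi2' : seq C := [:: 2; -2; 0; 0; 1; -1; - sqrtC 2; sqrtC 2].
Definition psi4 : seq C := [:: 4; -4; 0; 0; -1; 1; 0; 0].

Definition V_1 (chi : seq C) := Label 1%g (zip char_elts chi).
Definition V_z (chi : seq C) := Label z (zip char_elts chi).
Definition V_t1 r := Label t1 [:: (t1, zeta 4 ^+ r)].
Definition V_t13 r :=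
  Label (t1 * t3)%g [:: ((t1 * t2 * t1 * t3 * t2)%g, zeta 8 ^+ r)].
Definition V_t12 r := Label (t1 * t2)%g [:: ((t1 * t2)%g, zeta 6 ^+ r)].
Definition V_zt12 r := Label (z * t1 * t2)%g [:: ((t1 * t2)%g, zeta 6 ^+ r)].
Definition V_t123 r :=
  Label (t1 * t2 * t3)%g [:: ((t1 * t2 * t3)%g, zeta 8 ^+ r)].
Definition V_zt123 r :=
  Label (z * t1 * t2 * t3)%g [:: ((t1 * t2 * t3)%g, zeta 8 ^+ r)].

(* Relative to the lists in the literature, chi3 and chi3' are exchanged, as
   are psi2 and psi2', and V_t13 2 replaces V_t13 6, which is in the same orbit
   under tensor product with V_(z,1). With the original lists, the rows of
   chi3, chi3' and V_t13 6 and the columns of psi2 and psi2' do not match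
   fourier_matrix: for instance the entry at V_(z,chi3) and V_(t1,zeta_4) is
   - 12 chi3(t1) / 24 = - 6 / 12, but 6 / 12 is expected in the first row. *)
Definition degree0 : 13.-tuple label :=
  [tuple V_z chi3'; V_t12 0; V_z chi2; V_1 triv; V_zt123 0; V_t123 6; V_t123 2;
         V_t13 2; V_z chi3; V_z eps; V_t12 4; V_t12 2; V_zt123 4].

Definition degree1 : 13.-tuple label :=
  [tuple V_t13 1; V_t13 3; V_t1 1; V_1 psi4; V_1 psi2; V_1 psi2'; V_t123 5;
         V_t123 3; V_t123 7; V_t123 1; V_zt12 1; V_zt12 5; V_zt12 3].

Let q : C := 3 * sqrtC 2.

Definition fourier_rows : seq (seq C) :=
  [:: [::  3;  3;  6; -6; -3; -3; -3; -3; -3; -3;  0;  0;  0];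
      [::  0;  0;  0; -4;  4;  4;  0;  0;  0;  0;  4;  4; -8];
      [:: -6; -6;  0; -4; -2; -2;  0;  0;  0;  0;  4;  4;  4];
      [::  3;  3;  6;  2;  1;  1;  3;  3;  3;  3;  4;  4;  4];
      [::  q; -q;  0;  0; -q;  q;  q;  q; -q; -q;  0;  0;  0];
      [::  q; -q;  0;  0;  q; -q; -q;  q; -q;  q;  0;  0;  0];
      [::  q; -q;  0;  0;  q; -q;  q; -q;  q; -q;  0;  0;  0];
      [::  0;  0;  0;  0;  0;  0;  6; -6; -6;  6;  0;  0;  0];
      [::  3;  3; -6; -6; -3; -3;  3;  3;  3;  3;  0;  0;  0];
      [:: -3; -3;  6; -2; -1; -1;  3;  3;  3;  3; -4; -4; -4];
      [::  0;  0;  0; -4;  4;  4;  0;  0;  0;  0;  4; -8;  4];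
      [::  0;  0;  0; -4;  4;  4;  0;  0;  0;  0; -8;  4;  4];
      [::  q; -q;  0;  0; -q;  q; -q; -q;  q;  q;  0;  0;  0]].

Definition fourier_matrix : 'M[C]_13 :=
  12^-1 *: \matrix_(i, j) (nth [::] fourier_rows i)`_j.

Definition fourier_F1 : 'M[C]_13 :=
  diag_mx (\row_i [:: 1; 1; 1; 1; 1; zeta 4; - zeta 4; -1; 1; 1;
                      zeta 3; zeta 3 ^+ 2; -1]`_i).

Definition fourier_F2 : 'M[C]_13 :=
  diag_mx (\row_i [:: 1; 1; 1; -1; -1; -1; - zeta 4; zeta 4; zeta 4; - zeta 4;
                      - zeta 3; - zeta 3 ^+ 2; -1]`_i).

End BinaryOctahedral.

(* Main.v *)
Require Import Defs.
From HB Require Import structures.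
From mathcomp Require Import all_boot all_order all_algebra all_fingroup all_solvable all_character.
From mathcomp Require Import complex reals.
From mathcomp Require Import ring.
Import GroupScope GRing.Theory Num.Theory.
Local Open Scope ring_scope.

Set Implicit Arguments.
Unset Strict Implicit.
Unset Printing Implicit Defensive.

(* For modules X and Y over the double, S_(X,Y) is the sum over the commuting
   pairs (h, g) of tr_X(e_h g) tr_Y(e_g h), and the twist is the action of the
   central element sum_g e_g g. On V_(a,rho) the trace of e_h g is tr rho(k) if
   (h, g) is conjugate to (a, k) with k in the centralizer of a, and the twist is
   the scalar by which rho(a) acts. So everything is a finite computation once
   the multiplication table of the group is known. The presentation rewrites
   every element to one of 48 normal forms; these are pairwise distinct because
   right multiplication on them defines permutations satisfying the relations,
   and the group is universal for these relations. All character values lie in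
   Z[zeta_24], where the computation is carried out exactly. *)

(** * Modules over the Drinfeld double *)

Section DoubleModule.
Variables (C : fieldType) (gT : finGroupType).
Implicit Types (g h k x : gT) (X Y : dd_module C gT).

Lemma dd_basis_elt h g x :
  dd_basis C h g * dd_elt C x = dd_basis C h (g * x)%g.
Proof.
rewrite /dd_elt mulr_sumr (bigD1 (h ^ g)%g) //= big1 ?addr0 => [|k kh].
  by rewrite [LHS]dd_basis_mul conjgE !mulgA mulgV mul1g mulgK eqxx scale1r.
rewrite [LHS]dd_basis_mul; case: eqP => [hk|_]; last by rewrite scale0r.
by case/eqP: kh; rewrite hk conjgE !mulgA mulVg mul1g mulgKV.
Qed.

Lemma dd_elt_basis h g x :
  dd_elt C x * dd_basis C (h ^ x)%g g = dd_basis C h (x * g)%g.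
Proof.
rewrite /dd_elt mulr_suml (bigD1 h) //= big1 ?addr0 => [|k kh].
  by rewrite [LHS]dd_basis_mul conjgE !mulgA mulgV mul1g mulgK eqxx scale1r.
rewrite [LHS]dd_basis_mul conjgE !mulgA mulgV mul1g mulgK.
by rewrite (negPf kh) scale0r.
Qed.

Lemma dd_sum_idem : \sum_(g : gT) dd_idem C g = 1.
Proof. by []. Qed.

Lemma dd_idem_basis k h g :
  dd_idem C k * dd_basis C h g = (k == h)%:R *: dd_basis C h g.
Proof.
rewrite [LHS]dd_basis_mul mul1g invg1 mulg1 mul1g.
by have [->|] := eqVneq k h; rewrite ?scale0r.
Qed.

Lemma dd_basis_idem h g k :
  dd_basis C h g * dd_idem C k = (h ^ g == k)%g%:R *: dd_basis C h g.
Proof.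
rewrite [LHS]dd_basis_mul mulg1; congr (_%:R *: _); congr nat_of_bool.
by rewrite -(inj_eq (conjg_inj g)) !conjgE !mulgA mulVg mul1g mulgKV.
Qed.

Lemma dd_idemK h : dd_idem C h * dd_idem C h = dd_idem C h.
Proof. by rewrite [LHS]dd_idem_basis eqxx scale1r. Qed.

Lemma mxtrace_actC X (a b : drinfeld_double C gT) :
  \tr (X (a * b)) = \tr (X (b * a)).
Proof. by rewrite !rmorphM -!mulmxE mxtrace_mulC. Qed.

(** The trace is cyclic, and [x^-1 (e_h g) x] is [e_(h^x) g^x] in the double. *)
Lemma mxtrace_act_conj X h g x :
  \tr (X (dd_basis C (h ^ x) (g ^ x))) = \tr (X (dd_basis C h g)).
Proof.
rewrite [(g ^ x)%g]conjgE mulgA -dd_basis_elt mxtrace_actC dd_elt_basis.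
by rewrite mulKVg.
Qed.

(** As [e_h] is idempotent, cyclicity replaces [e_h g] by [(e_h g) e_h], which vanishes unless
    [h ^ g = h]. *)
Lemma mxtrace_act_ncomm X h g :
  (g * h != h * g)%g -> \tr (X (dd_basis C h g)) = 0.
Proof.
move=> gh.
have -> : dd_basis C h g = dd_idem C h * dd_basis C h g.
  by rewrite dd_idem_basis eqxx scale1r.
rewrite mxtrace_actC dd_basis_idem conjgE.
rewrite -(inj_eq (mulgI g)) mulKVg eq_sym (negPf gh).
by rewrite scale0r !raddf0.
Qed.

Lemma mxtrace_act_out X a h g :
  (forall k, k \notin (a ^: [set: gT])%g -> X (dd_idem C k) = 0) ->
  h \notin (a ^: [set: gT])%g -> \tr (X (dd_basis C h g)) = 0.
Proof. by move=> Xout /Xout X0; rewrite dd_basisE rmorphM /= X0 mul0r raddf0. Qed.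

Lemma mulmx_delta_tr m n p q (A : 'M[C]_(m, p)) (B : 'M[C]_(n, q))
    (i : 'I_m) (j : 'I_n) (k : 'I_p) (l : 'I_q) :
  (A *m delta_mx k l *m B^T) i j = A i k * B j l.
Proof.
rewrite -mulmxA mxE (bigD1 k) //= big1 ?addr0 => [|k' k'k]; last first.
  rewrite mxE big1 ?mulr0 // => l' _.
  by rewrite mxE (negPf k'k) mul0r.
congr (_ * _).
rewrite mxE (bigD1 l) //= big1 ?addr0 => [|l' l'l].
  by rewrite !mxE !eqxx mul1r.
by rewrite mxE (negPf l'l) andbF mul0r.
Qed.

Lemma mxtrace_lin_mx m n (f : 'M[C]_(m, n) -> 'M[C]_(m, n)) :
  \tr (lin_mx f) = \sum_i \sum_j f (delta_mx i j) i j.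
Proof.
rewrite /mxtrace pair_big /=.
rewrite (reindex (uncurry (@mxvec_index m n))); last exact: curry_mxvec_bij.
apply: eq_bigr => -[i j] _.
by rewrite /lin_mx mxE /= vec_mx_delta mxvecE.
Qed.

Lemma double_braidingE X Y u :
  braiding (@braiding C gT X Y u) =
  \sum_h \sum_g
    X (dd_basis C h g) *m u *m (Y (dd_elt C h * dd_idem C g))^T.
Proof.
rewrite /braiding raddf_sum; apply: eq_bigr => h _ /=.
rewrite trmx_mul trmxK trmx_mul trmxK mulmx_suml mulmx_sumr.
apply: eq_bigr => g _; rewrite dd_basisE !rmorphM /= -!mulmxE trmx_mul.
by rewrite !mulmxA.
Qed.

Lemma S_coefE X Y :
  S_coef X Y =
  \sum_h \sum_g \tr (X (dd_basis C h g)) * \tr (Y (dd_basis C g h)).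
Proof.
rewrite /S_coef mxtrace_lin_mx /=.
under eq_bigr => i _.
  under eq_bigr => j _.
    rewrite double_braidingE summxE.
    under eq_bigr => h _.
      rewrite summxE; under eq_bigr => g _ do rewrite mulmx_delta_tr.
    over.
  over.
  rewrite exchange_big.
over.
rewrite exchange_big; apply: eq_bigr => h _ /=.
under eq_bigr => i _ do rewrite exchange_big.
rewrite exchange_big; apply: eq_bigr => g _ /=.
(* By cyclicity [h e_g] has the same trace as [e_g h]; the sum over [i] and [j] then factors into
   two traces. *)
by rewrite (dd_basisE C g) [X in _ = _ * X]mxtrace_actC [RHS]big_distrlr.
Qed.

(** The sum over [j] contracts each term of the R-matrix, the tensor of [g] and [e_g], to the
    product [e_g g]. *)
Lemma twistE X : twist X = X (\sum_g dd_basis C g g).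
Proof.
rewrite raddf_sum /=; apply/matrixP => i k; rewrite summxE mxE.
under eq_bigr => j _.
  rewrite mxE summxE; under eq_bigr => g _ do rewrite mulmx_delta_tr mulrC.
over.
rewrite exchange_big; apply: eq_bigr => g _.
by rewrite dd_basisE rmorphM /= -mulmxE mxE.
Qed.

Section Induced.
Variables (X : dd_module C gT) (a : gT) (d : nat).
Variables (rho : mx_representation C 'C[a]%G d) (XV : is_V X rho).

(** The columns of [P] span the image of the idempotent [e_a], so [e_a] factors as [P Q] and fixes
    [P]. From [P Q P = P], full column rank of [P] gives [Q P = 1]. *)
Lemma is_V_frame :
  exists (P : 'M[C]_(dd_dim X, d)) (Q : 'M[C]_(d, dd_dim X)),
    [/\ X (dd_idem C a) = P *m Q, Q *m P = 1%:M
      & {in 'C[a]%g, forall h, X (dd_elt C h) *m P = P *m rho h}].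
Proof.
case: XV => _ _ [P [Pfree /andP[PX XP] Prho]].
have [Q XaE] : exists Q, X (dd_idem C a) = P *m Q.
  by case/submxP: XP => D XD; exists D^T; rewrite -[LHS]trmxK XD trmx_mul trmxK.
have XaP : X (dd_idem C a) *m P = P.
  case/submxP: PX => D PD; rewrite -[P in LHS]trmxK PD trmx_mul trmxK mulmxA.
  by rewrite mulmxE -rmorphM dd_idemK -[RHS]trmxK PD trmx_mul trmxK.
exists P, Q; split=> //; apply: trmx_inj; apply: (row_free_inj Pfree).
by rewrite /= -!trmx_mul mulmx1 mulmxA -XaE XaP.
Qed.

Lemma mxtrace_is_V h :
  h \in 'C[a]%g -> \tr (X (dd_basis C a h)) = \tr (rho h).
Proof.
move=> ah; have [P [Q [XaE QP Prho]]] := is_V_frame.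
rewrite dd_basisE mxtrace_actC rmorphM /= -mulmxE XaE mulmxA Prho //.
by rewrite mxtrace_mulC mulmxA QP mul1mx.
Qed.

(** The sum of the [e_g g] is compared termwise with [s] times the sum of the [e_g], which is 1. Off
    the class of [a] both terms vanish; on it, conjugation reduces to
    [e_a a = a e_a = P rho(a) Q = s e_a]. *)
Lemma twist_is_V s : rho a = s%:M -> twist X = s%:M.
Proof.
move=> rhoa; have [P [Q [XaE _ Prho]]] := is_V_frame; case: XV => _ Xout _.
have Xaa : X (dd_basis C a a) = s *: X (dd_idem C a).
  have <- : dd_elt C a * dd_idem C a = dd_basis C a a.
    by have := dd_elt_basis a 1 a; rewrite conjgE mulKg mulg1.
  rewrite rmorphM /= -mulmxE XaE mulmxA Prho ?cent1id // rhoa.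
  by rewrite mul_mx_scalar scalemxAl.
rewrite twistE raddf_sum.
transitivity (\sum_g s *: X (dd_idem C g)); last first.
  by rewrite -scaler_sumr -raddf_sum /= dd_sum_idem rmorph1 scalemx1.
apply: eq_bigr => g _ /=.
have [/imsetP[x _ ->]|gout] := boolP (g \in (a ^: [set: gT])%g); last first.
  by rewrite dd_basisE rmorphM /= (Xout _ gout) mul0r scaler0.
have conj_act h :
  dd_elt C x^-1%g * dd_basis C a h * dd_elt C x = dd_basis C (a ^ x) (h ^ x).
  have := dd_elt_basis (a ^ x) h x^-1; rewrite conjgK => ->.
  by rewrite dd_basis_elt -mulgA -conjgE.
rewrite -conj_act -[dd_idem _ _]/(dd_basis C (a ^ x) 1%g) -(conj1g x) -conj_act.
by rewrite !rmorphM /= Xaa -!mulmxE -scalemxAr -scalemxAl.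
Qed.
End Induced.

End DoubleModule.

(** * Schur's lemma over an algebraically closed field *)

Section Schur.
Variables (C : closedFieldType) (gT : finGroupType) (G : {group gT}).

Lemma irr_central_scalar d (rho : mx_representation C G d) a :
  mx_irreducible rho -> a \in 'Z(G)%g -> exists s, rho a = s%:M.
Proof.
move=> irr /setIP[Ga /centP cGa].
have absG : mx_absolutely_irreducible rho by apply: group_closure_closed_field.
apply/is_scalar_mxP; apply: (mx_abs_irr_cent_scalar absG).
by apply/centgmxP => g Gg; rewrite -!repr_mxM // cGa.
Qed.

Lemma irr_abelian_linear d (rho : mx_representation C G d) :
  mx_irreducible rho -> abelian G -> d = 1%N.
Proof.
move=> irr cGG; apply: (mx_irr_abelian_linear _ irr cGG).
exact: group_closure_closed_field.
Qed.
End Schur.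

(** * Normal forms in the binary octahedral group *)

Inductive gen := Gen1 | Gen2 | Gen3.

(* The normal form z^e t1^a B C, with B among 1, t2, t2 t1 and C among
   1, t3, t3 t2, t3 t2 t1. *)
Definition code := ((bool * bool) * option bool * option (option bool))%type.

Definition one_code : code := (false, false, None, None).

(** There is no letter for [z]: it is spelled [t1 t1], whence [e.*2]. *)
Definition word (x : code) : seq gen :=
  let: (e, a, b, c) := x in
  nseq e.*2 Gen1 ++ nseq a Gen1 ++
  (if b is Some b' then Gen2 :: nseq b' Gen1 else [::]) ++
  match c with
  | None => [::]
  | Some None => [:: Gen3]
  | Some (Some c') => Gen3 :: Gen2 :: nseq c' Gen1
  end.

Definition negz (p : bool * bool) := (~~ p.1, p.2).

Definition step1 (p : bool * bool) := (p.1 (+) p.2, ~~ p.2).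

Definition step2 k (p : (bool * bool) * option bool) :=
  let: (s, b) := p in
  match b, k with
  | None, Gen2 => (s, Some false)
  | None, _ => (step1 s, None)
  | Some false, Gen2 => (negz s, None)
  | Some false, _ => (s, Some true)
  | Some true, Gen2 => (step1 s, b)
  | Some true, _ => (negz s, Some false)
  end.

(* Right multiplication by a generator. Besides the relations for t1 and t2,
   it uses t3 t1 = z t1 t3, t3 t2 t3 = t2 t3 t2 and
   t3 t2 t1 t3 = z t2 t3 t2 t1. *)
Definition step k (x : code) : code :=
  let: (p, c) := x in
  let: p' := (negz p.1, p.2) in
  match c, k with
  | None, Gen3 => (p, Some None)
  | None, _ => (step2 k p, None)
  | Some None, Gen1 => (step2 Gen1 p', c)
  | Some None, Gen2 => (p, Some (Some false))
  | Some None, Gen3 => (p', None)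
  | Some (Some false), Gen1 => (p, Some (Some true))
  | Some (Some false), Gen2 => (p', Some None)
  | Some (Some false), Gen3 => (step2 Gen2 p, c)
  | Some (Some true), Gen1 => (p', Some (Some false))
  | Some (Some true), Gen2 => (step2 Gen1 p', c)
  | Some (Some true), Gen3 => (step2 Gen2 p', c)
  end.

Definition act_word := foldl (fun x k => step k x).
Definition of_word := act_word one_code.
Definition mul_code x y := act_word x (word y).

(* The inverse of t_k is t_k^3. *)
Definition inv_word (s : seq gen) := flatten [seq nseq 3 k | k <- rev s].
Definition conj_code k x := of_word (inv_word (word x) ++ word k ++ word x).

Definition codes : seq code :=
  [seq (p, c) | p <- [seq (s, b) | s <- [seq (e, a) | e <- [:: false; true],
                                                      a <- [:: false; true]],
                                   b <- [:: None; Some false; Some true]],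
                c <- [:: None; Some None; Some (Some false); Some (Some true)]].

Lemma mem_codes x : x \in codes.
Proof. by case: x => [[[[] []] [[]|]] [[[]|]|]]; vm_compute. Qed.

Lemma uniq_codes : uniq codes.
Proof. by vm_compute. Qed.

(** The cube of [step k] inverts it, as [t_k ^ 4 = z ^ 2 = 1]. *)
Lemma step_inj k : injective (step k).
Proof.
apply: (can_inj (g := fun x => step k (step k (step k x)))).
by case: k => -[[[[] []] [[]|]] [[[]|]|]].
Qed.

Lemma of_wordK x : of_word (word x) = x.
Proof. by case: x => [[[[] []] [[]|]] [[[]|]|]]. Qed.

Lemma act_word_rcons x s k : act_word x (rcons s k) = step k (act_word x s).
Proof. by rewrite /act_word -cats1 foldl_cat. Qed.

(** * Permutation model on the 48 codes *)

Definition step_perm k : {perm code} := perm (@step_inj k).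

(** This join of cyclic groups is the form to which [Grp] unfolds, so the generation condition of
    the presentation holds by reflexivity. *)
Definition perm_group : {group {perm code}} :=
  (<[step_perm Gen1 ^+ 2]> <*> <[step_perm Gen1]> <*> <[step_perm Gen2]>
    <*> <[step_perm Gen3]>)%G.

Lemma mem_step_perm k : step_perm k \in perm_group.
Proof.
case: k => /=.
- by do 2!apply: (subsetP (joing_subl _ _)); apply: (subsetP (joing_subr _ _)); rewrite cycle_id.
- by apply: (subsetP (joing_subl _ _)); apply: (subsetP (joing_subr _ _)); rewrite cycle_id.
- by apply: (subsetP (joing_subr _ _)); rewrite cycle_id.
Qed.

(** The orbit of [one_code] is everything, since [word x] leads from it to [x], and an orbit has no
    more points than the group has elements. *)
Lemma card_perm_group : (#|{: code}| <= #|perm_group|)%N.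
Proof.
rewrite -cardsT.
suff sub : [set: code] \subset [set aperm one_code s | s in perm_group].
  exact: leq_trans (subset_leq_card sub) (leq_imset_card _ _).
apply/subsetP => x _; rewrite -(of_wordK x) /of_word.
elim/last_ind: (word x) => [|s k /imsetP[p Hp px]].
  by apply/imsetP; exists 1%g; rewrite ?group1 // /aperm perm1.
apply/imsetP; exists (p * step_perm k)%g; first by rewrite groupM ?mem_step_perm.
by rewrite act_word_rcons /aperm permM permE px.
Qed.

Lemma perm_group_hom :
  perm_group \homg Grp (z : t1 : t2 : t3 :
         z ^+ 2, t1 ^+ 2 = z, t2 ^+ 2 = z, t3 ^+ 2 = z,
         (t1 * t2) ^+ 3 = z, (t2 * t3) ^+ 3 = z, (t1 * t3) ^+ 2 = z)%g.
Proof.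
(* [z] is sent to the square of the image of [t1]; each relation is then checked at all 48 codes. *)
apply/existsP; exists (step_perm Gen1 ^+ 2, step_perm Gen1, step_perm Gen2, step_perm Gen3)%g.
rewrite /= !xpair_eqE eqxx /=.
by apply/and5P; split; [..|apply/and3P; split]; apply/eqP/permP => x;
  rewrite !expgS !expg0 !mulg1 !permM !permE ?perm1;
  case: x => [[[[] []] [[]|]] [[[]|]|]].
Qed.

(** Multiplied by [x] on the left and by [x y] on the right, both sides become [z]: the left one is
    [(x y)^3], the right one is [z y z y = y^2]. *)
Lemma braid_of_cube (gT : finGroupType) (z x y : gT) :
  (z * z = 1)%g -> (x * x = z)%g -> (y * y = z)%g -> ((x * y) ^+ 3 = z)%g ->
  (y * x * y = x * y * x)%g.
Proof.
move=> zz xx yy xy3; have zy : (z * y = y * z)%g by rewrite -yy mulgA.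
apply: (mulgI x); apply: (mulIg (x * y)%g).
have -> : (x * (y * x * y) * (x * y) = z)%g by rewrite -xy3 !expgS expg0 mulg1 !mulgA.
have -> : (x * (x * y * x) * (x * y) = (x * x) * y * (x * x) * y)%g by rewrite !mulgA.
by rewrite xx -[(z * y * z)%g]mulgA -zy mulgA zz mul1g yy.
Qed.

(** * Evaluation of codes in the binary octahedral group *)

Section Codes.
Variables (gT : finGroupType) (z t1 t2 t3 : gT).
Hypothesis hG : binary_octahedral z t1 t2 t3.

Definition gen_val k := match k with Gen1 => t1 | Gen2 => t2 | Gen3 => t3 end.
Definition word_val s := (\prod_(k <- s) gen_val k)%g.
Definition val_code x := word_val (word x).

Lemma word_val_cat s1 s2 : word_val (s1 ++ s2) = (word_val s1 * word_val s2)%g.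
Proof. exact: big_cat. Qed.

Lemma word_val1 k : word_val [:: k] = gen_val k.
Proof. exact: big_seq1. Qed.

Let zz : (z * z = 1)%g. Proof. by case: hG => -[]. Qed.
Let t11 : (t1 * t1 = z)%g. Proof. by case: hG => -[]. Qed.
Let t22 : (t2 * t2 = z)%g. Proof. by case: hG => -[]. Qed.
Let t33 : (t3 * t3 = z)%g. Proof. by case: hG => -[]. Qed.

Lemma gen_val_sqr k : (gen_val k * gen_val k = z)%g.
Proof. by case: k. Qed.

(** [z] is the square of each [t_i], so it commutes with all the generators. *)
Lemma z_central x : (z * x = x * z)%g.
Proof.
have zgen k : gen_val k \in 'C[z]%g.
  by apply/cent1P; rewrite -(gen_val_sqr k) /commute mulgA.
have: x \in [set: gT] by rewrite inE.
have [_ _ <- _] := hG; move=> xG; apply/esym/cent1P.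
suff sub : <<[set z; t1; t2; t3]>>%g \subset 'C[z]%g by apply: (subsetP sub).
rewrite gen_subG; apply/subsetP => y; rewrite !in_setU !in_set1 -!orbA.
case/or4P => /eqP->; first exact: cent1id.
- exact: zgen Gen1.
- exact: zgen Gen2.
- exact: zgen Gen3.
Qed.

Lemma gen_valV k : ((gen_val k)^-1 = gen_val k * z)%g.
Proof. by apply: (mulgI (gen_val k)); rewrite mulgV mulgA gen_val_sqr zz. Qed.

Let t31 : (t3 * t1 = z * t1 * t3)%g.
Proof.
have [_ [_ _ e13] _ _] := hG.
apply: (mulgI t1); apply: (mulIg t3).
have -> : (t1 * (t3 * t1) * t3 = z)%g by rewrite -[RHS]e13 expgS expg1 !mulgA.
by rewrite !mulgA -z_central -[(z * t1 * t1)%g]mulgA t11 zz mul1g t33.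
Qed.

Let t212 : (t2 * t1 * t2 = t1 * t2 * t1)%g.
Proof. by have [_ [e12 _ _] _ _] := hG; apply: (braid_of_cube zz). Qed.

Let t323 : (t3 * t2 * t3 = t2 * t3 * t2)%g.
Proof. by have [_ [_ e23 _] _ _] := hG; apply: (braid_of_cube zz). Qed.

Definition val1 (p : bool * bool) := (z ^+ p.1 * t1 ^+ p.2)%g.

Definition val2 (p : (bool * bool) * option bool) :=
  (val1 p.1 * (if p.2 is Some b then t2 * t1 ^+ b else 1))%g.

Definition val3 (x : code) :=
  (val2 x.1 * match x.2 with
   | None => 1
   | Some None => t3
   | Some (Some b) => t3 * (t2 * t1 ^+ b)
   end)%g.

Lemma val_codeE x : val_code x = val3 x.
Proof.
rewrite /val_code /word_val /val3 /val2 /val1.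
case: x => [[[e a] b] c] /=; rewrite !big_cat /= -!mulgA.
case: e; case: a; case: b => [[]|]; case: c => [[[]|]|];
  by rewrite /= ?(big_cons, big_nil, expg0, expg1, mulg1, mul1g) /= -?t11 -?mulgA.
Qed.

Arguments val1 : simpl never.
Arguments val2 : simpl never.
Arguments step2 : simpl never.

Lemma val1_negz p : val1 (negz p) = (val1 p * z)%g.
Proof.
by case: p => [[] a]; rewrite -z_central /val1 /= mulgA ?expg0 ?expg1 ?zz ?mulg1.
Qed.

Lemma val2_negz p : val2 (negz p.1, p.2) = (val2 p * z)%g.
Proof. by rewrite /val2 val1_negz -!mulgA z_central. Qed.

Lemma val1_step p : val1 (step1 p) = (val1 p * t1)%g.
Proof.
case: p => e []; rewrite /val1 /= ?addbF ?addbT ?expg0 ?mulg1 ?expg1 //.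
by rewrite -mulgA t11; case: e; rewrite /= ?expg0 ?expg1 ?zz ?mul1g.
Qed.

Lemma val2_step k p : k <> Gen3 -> val2 (step2 k p) = (val2 p * gen_val k)%g.
Proof.
case: k p => // -[s [[]|]] _;
  rewrite /step2 /val2 /= ?expg0 ?expg1 ?mulg1 ?val1_step ?val1_negz // -!mulgA //.
- by rewrite t11 -z_central.
- by rewrite (mulgA t2) t212 !mulgA.
- by rewrite t22.
Qed.

(** Soundness of the rewriting rules: once the common left factor [v] is removed, each remaining
    goal is one rule of [step]. *)
Lemma val_code_step k x : val_code (step k x) = (val_code x * gen_val k)%g.
Proof.
have zCA x' y : (x' * (z * y) = z * (x' * y))%g by rewrite !mulgA z_central.
have t13 : (t1 * t3 = z * (t3 * t1))%g by rewrite t31 !mulgA zz mul1g.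
rewrite !val_codeE; case: x => p c; rewrite /val3.
case: c k => [[[]|]|] [] /=;
  rewrite ?val2_step ?val2_negz //=; move: (val2 p) => v;
  rewrite ?expg0 ?expg1 ?mulg1 -?mulgA //; congr (_ * _)%g.
- by rewrite t11 z_central mulgA.
- by rewrite (mulgA t2) t212 !mulgA t31.
(* In [t3 t2 t1 t3], replacing [t1 t3] by [z t3 t1] exposes the braid word [t3 t2 t3]. *)
- by rewrite t13 !zCA; congr (_ * _)%g; rewrite !mulgA t323.
- by rewrite t22 z_central.
- by rewrite !mulgA t323.
- by rewrite t31 mulgA.
- by rewrite t33.
Qed.

Lemma val_code_act x s : val_code (act_word x s) = (val_code x * word_val s)%g.
Proof.
elim: s x => [|k s IHs] x /=; first by rewrite /word_val big_nil mulg1.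
by rewrite IHs val_code_step /word_val big_cons mulgA.
Qed.

Lemma val_one : val_code one_code = 1%g.
Proof. exact: big_nil. Qed.

Lemma val_of_word s : val_code (of_word s) = word_val s.
Proof. by rewrite val_code_act val_one mul1g. Qed.

Lemma val_mul_code x y : val_code (mul_code x y) = (val_code x * val_code y)%g.
Proof. exact: val_code_act. Qed.

Lemma val_inv_word s : word_val (inv_word s) = (word_val s)^-1%g.
Proof.
elim/last_ind: s => [|s k IHs]; first by rewrite /word_val big_nil invg1.
rewrite /inv_word rev_rcons /= -/(inv_word s) /word_val !big_cons.
rewrite -/(word_val (inv_word s)) IHs -cats1 -/(word_val _) word_val_cat invMg.
rewrite !mulgA {2}/word_val big_seq1 gen_valV.
by rewrite -(mulgA (gen_val k)) gen_val_sqr.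
Qed.

Lemma val_conj_code k x :
  val_code (conj_code k x) = (val_code k ^ val_code x)%g.
Proof. by rewrite val_of_word !word_val_cat val_inv_word. Qed.

(** The image [W] is closed under products and contains the generators, so it is the whole group.
    Injectivity is by counting: the group maps onto [perm_group], which has at least as many
    elements as there are codes. *)
Lemma val_code_bij : bijective val_code.
Proof.
pose W := [set val_code x | x : code].
have gW : group_set W.
  apply/group_setP; split=> [|_ _ /imsetP[x _ ->] /imsetP[y _ ->]].
    by rewrite -val_one imset_f.
  by rewrite -val_mul_code imset_f.
have WT : [set: gT] \subset W.
  have [_ _ <- _] := hG; rewrite (gen_subG _ (Group gW)) /=.
  have Wgen k : gen_val k \in W.
    by rewrite -word_val1 -val_of_word imset_f.
  apply/subsetP => y; rewrite !in_setU !in_set1 -!orbA.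
  case/or4P => /eqP->; rewrite ?(Wgen Gen1) ?(Wgen Gen2) ?(Wgen Gen3) //.
  by rewrite -(gen_val_sqr Gen1) -word_val1 -val_of_word -val_mul_code imset_f.
(* This is the universal property of the presentation, applied to permutations that satisfy its
   relations. *)
have homG : perm_group \homg [set: gT].
  by have [_ _ _ ->] := hG; apply: perm_group_hom.
have WC : #|W| == #|{: code}|.
  rewrite eqn_leq leq_imset_card (leq_trans card_perm_group) //.
  apply: leq_trans (subset_leq_card WT).
  by case/homgP: homG => f <-; apply: leq_morphim.
apply: inj_card_bij; first by move/imset_injP: WC => injW x y; apply: injW.
by rewrite -cardsT -(eqP WC) subset_leq_card.
Qed.

Lemma sum_codes (V : nmodType) (F : gT -> V) :
  \sum_g F g = \sum_(x <- codes) F (val_code x).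
Proof.
rewrite (reindex val_code) /=; last exact: onW_bij val_code_bij.
apply: perm_big; apply: uniq_perm; rewrite ?index_enum_uniq ?uniq_codes // => x.
by rewrite mem_index_enum mem_codes.
Qed.
End Codes.

(** * Exact arithmetic with 24-th roots of unity *)

(* Coefficients on the powers of a primitive 24-th root of unity. *)
Definition cyc := seq int.

Fixpoint cyc_add (p q : cyc) : cyc :=
  match p, q with
  | [::], _ => q
  | _, [::] => p
  | a :: p', b :: q' => (a + b) :: cyc_add p' q'
  end.

Definition cyc_scale (a : int) (p : cyc) : cyc := [seq a * b | b <- p].

(* Multiplication by the root x, where x^8 = x^4 - 1. *)
Definition cyc_mulx (p : cyc) : cyc :=
  if p is [:: a0; a1; a2; a3; a4; a5; a6; a7]
  then [:: - a7; a0; a1; a2; a3 + a7; a4; a5; a6] else 0 :: p.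

Fixpoint cyc_mul (p q : cyc) : cyc :=
  if p is a :: p' then cyc_add (cyc_scale a q) (cyc_mulx (cyc_mul p' q)) else [::].

Definition cyc_exp n : cyc := iter n cyc_mulx [:: 1].

(** The difference is tested, so that lists differing by trailing zeros agree. *)
Definition cyc_eq (p q : cyc) := all (pred1 0) (cyc_add p (cyc_scale (-1) q)).

Definition cyc_sum (s : seq cyc) := foldr cyc_add [::] s.

(* inl n stands for the integer n, inr b for s or - s according to b. *)
Definition entry := (int + bool)%type.

Definition cyc_of_entry (s : cyc) (e : entry) : cyc :=
  match e with
  | inl n => [:: n]
  | inr b => if b then s else cyc_scale (-1) s
  end.

Definition entry_val (R : pzRingType) (s : R) (e : entry) : R :=
  match e with
  | inl n => n%:~R
  | inr b => if b then s else - s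
  end.

Section CycVal.
Variables (R : comPzRingType) (x : R).
Hypothesis x8 : x ^+ 8 = x ^+ 4 - 1.

Definition cyc_val (p : cyc) : R := foldr (fun a r => a%:~R + x * r) 0 p.

Lemma cyc_val_add p q : cyc_val (cyc_add p q) = cyc_val p + cyc_val q.
Proof.
elim: p q => [|a p IHp] [|b q] /=; rewrite ?add0r ?addr0 //.
by rewrite IHp intrD mulrDr addrACA.
Qed.

Lemma cyc_val_scale a p : cyc_val (cyc_scale a p) = a%:~R * cyc_val p.
Proof.
elim: p => [|b p IHp] /=; first by rewrite mulr0.
by rewrite IHp intrM mulrDr mulrCA.
Qed.

Lemma cyc_val_mulx p : cyc_val (cyc_mulx p) = x * cyc_val p.
Proof.
have gen q : cyc_val (0 :: q) = x * cyc_val q by rewrite /= mulr0z add0r.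
case: p => [|a0 [|a1 [|a2 [|a3 [|a4 [|a5 [|a6 [|a7 [|a8 p]]]]]]]]];
  rewrite ?gen //=.
have x8' : x ^+ 8 - x ^+ 4 + 1 = 0 by rewrite x8; ring.
rewrite mulrNz intrD; apply/subr0_eq.
(* Reducing [a7 x^8] changes the formal value by a multiple of the 24-th cyclotomic polynomial
   [x^8 - x^4 + 1]. *)
transitivity (- a7%:~R * (x ^+ 8 - x ^+ 4 + 1)); last by rewrite x8' mulr0.
by ring.
Qed.

Lemma cyc_val_mul p q : cyc_val (cyc_mul p q) = cyc_val p * cyc_val q.
Proof.
elim: p => [|a p IHp] /=; first by rewrite mul0r.
by rewrite cyc_val_add cyc_val_scale cyc_val_mulx IHp mulrDl mulrA.
Qed.

Lemma cyc_val_exp n : cyc_val (cyc_exp n) = x ^+ n.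
Proof.
elim: n => [|n IHn]; first by rewrite /= mulr0 addr0.
by rewrite /cyc_exp iterS cyc_val_mulx IHn exprS.
Qed.

Lemma cyc_val_sum s : cyc_val (cyc_sum s) = \sum_(p <- s) cyc_val p.
Proof.
elim: s => [|p s IHs]; first by rewrite big_nil.
by rewrite big_cons /= cyc_val_add IHs.
Qed.

Lemma cyc_eqP p q : cyc_eq p q -> cyc_val p = cyc_val q.
Proof.
rewrite /cyc_eq => pq; apply/subr0_eq.
have <- : cyc_val (cyc_add p (cyc_scale (-1) q)) = cyc_val p - cyc_val q.
  by rewrite cyc_val_add cyc_val_scale mulN1r.
elim: cyc_add pq => //= a r IHr /andP[/eqP-> /IHr->].
by rewrite mulr0 addr0.
Qed.

Lemma cyc_val_entry s e :
  cyc_val (cyc_of_entry s e) = entry_val (cyc_val s) e.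
Proof.
case: e => [n|[]] //=; first by rewrite mulr0 addr0.
by rewrite cyc_val_scale mulN1r.
Qed.

End CycVal.

(* A code for the object V_(a, rho): the code of a, and the values of the
   character of rho at some elements of the centralizer of a. *)
Definition vdata := (code * seq (code * cyc))%type.

Definition comm_code x y := mul_code x y == mul_code y x.

Definition comm_pairs : seq (code * code) :=
  [seq p <- [seq (h, g) | h <- codes, g <- codes] | comm_code p.1 p.2].

Fixpoint assoc (T : eqType) (V : Type) (key : T) (l : seq (T * V)) : option V :=
  if l is (k, v) :: l' then if k == key then Some v else assoc key l' else None.

Fixpoint dedup (T : eqType) (V : Type) (l : seq (T * V)) : seq (T * V) :=
  if l is e :: l' then
    let u := dedup l' in if assoc e.1 u is Some _ then u else e :: u
  else [::].

(** The prescribed values are carried along the class by simultaneous conjugation of the pair. Every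
    entry is a correct trace, so whichever duplicate survives is right; removing the others shortens
    the lookups. *)
Definition char_table (d : vdata) : seq ((code * code) * cyc) :=
  dedup [seq ((conj_code d.1 y, conj_code kv.1 y), kv.2) | y <- codes, kv <- d.2].

(** The default [[::]] evaluates to 0, which is the trace off the conjugacy class. *)
Definition vchar (t : seq ((code * code) * cyc)) (p : code * code) : cyc :=
  odflt [::] (assoc p t).

(** The second test says that enough values are prescribed: a commuting pair missing from the table
    has its first member outside the class. *)
Definition vdata_valid (d : vdata) :=
  let t := char_table d in
  let cl := [seq conj_code d.1 y | y <- codes] in
  all (fun kv => comm_code d.1 kv.1) d.2 &&
  all (fun p => isSome (assoc p t) || (p.1 \notin cl)) comm_pairs.

(** By Schur [rho(a)] is a scalar, so [chi(a) = x^n chi(1)] identifies it as [x^n]. *)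
Definition vdata_twist (d : vdata) n :=
  match assoc one_code d.2, assoc d.1 d.2 with
  | Some u, Some v => cyc_eq v (cyc_mul (cyc_exp n) u)
  | _, _ => false
  end.

Lemma assoc_mem (T : eqType) (V : eqType) (key : T) (l : seq (T * V)) v :
  assoc key l = Some v -> (key, v) \in l.
Proof.
elim: l => //= -[k w] l IHl; case: eqP => [-> [->]|_ /IHl].
  by rewrite mem_head.
by rewrite inE orbC => ->.
Qed.

Lemma mem_dedup (T V : eqType) (l : seq (T * V)) : {subset dedup l <= l}.
Proof.
elim: l => //= e l IHl y; case: assoc => [_|] /=.
  by move=> /IHl yl; rewrite inE yl orbT.
by rewrite !inE => /predU1P[->|/IHl->]; rewrite ?eqxx ?orbT.
Qed.

Lemma sum_filter_pairs (V : nmodType) (T : Type) (s : seq T) (P : pred (T * T))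
    (F : T * T -> V) :
  \sum_(p <- [seq p <- [seq (h, g) | h <- s, g <- s] | P p]) F p =
  \sum_(h <- s) \sum_(g <- s) if P (h, g) then F (h, g) else 0.
Proof. by rewrite big_filter big_mkcond /= big_allpairs_dep. Qed.

(** * S-coefficients and twists from finite character data *)

Section Represents.
Variables (C : numClosedFieldType) (gT : finGroupType) (z t1 t2 t3 : gT).
Hypothesis hG : binary_octahedral z t1 t2 t3.
Variable x : C.
Hypothesis x8 : x ^+ 8 = x ^+ 4 - 1.
Notation w := (val_code t1 t2 t3).
Notation ev := (cyc_val x).

Definition represents (X : dd_module C gT) (d : vdata) : Prop :=
  exists n (rho : mx_representation C 'C[w d.1]%G n),
    [/\ mx_irreducible rho, is_V X rho &
        {in d.2, forall kv, \tr (rho (w kv.1)) = ev kv.2}].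

Lemma comm_codeP k l : reflect (commute (w k) (w l)) (comm_code k l).
Proof.
rewrite /comm_code /commute -!(val_mul_code hG).
by rewrite -(bij_eq (val_code_bij hG)); apply: eqP.
Qed.

Lemma mxtrace_vchar X d p :
  represents X d -> vdata_valid d -> p \in comm_pairs ->
  \tr (X (dd_basis C (w p.1) (w p.2))) = ev (vchar (char_table d) p).
Proof.
move=> [n [rho [_ XV rhoD]]] /andP[/allP commD /allP valid] pc.
rewrite /vchar; have := valid p pc; case E: (assoc p _) => [v|] out.
  case/allpairsP: (mem_dedup (assoc_mem E)) => -[y [k u]] /= [_ kD [-> ->]] /=.
  rewrite !(val_conj_code hG) mxtrace_act_conj (mxtrace_is_V XV) ?(rhoD _ kD) //.
  apply/cent1P/commute_sym; have /comm_codeP := commD _ kD; exact.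
have {out}out : p.1 \notin [seq conj_code d.1 y | y <- codes] := out.
case: XV => _ Xout _; rewrite (mxtrace_act_out _ Xout) //.
apply: contra out => /imsetP[y _ py]; apply/mapP.
case: (val_code_bij hG) => w' w'K wK; exists (w' y); first exact: mem_codes.
by apply: (bij_inj (val_code_bij hG)); rewrite (val_conj_code hG) wK.
Qed.

Definition S_dot (u v : seq cyc) := cyc_sum [seq cyc_mul p.1 p.2 | p <- zip u v].
Definition vrow d := let t := char_table d in [seq vchar t p | p <- comm_pairs].
(** The pairs are swapped to match the second factor [tr_Y(e_g h)] of the sum for [S_coef]. *)
Definition vcol d :=
  let t := char_table d in [seq vchar t (p.2, p.1) | p <- comm_pairs].

Lemma S_coef_codes X Y dX dY :
  represents X dX -> represents Y dY -> vdata_valid dX -> vdata_valid dY ->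
  S_coef X Y = ev (S_dot (vrow dX) (vcol dY)).
Proof.
move=> XdX YdY vX vY; rewrite S_coefE (sum_codes hG).
under eq_bigr => h _ do rewrite (sum_codes hG).
rewrite cyc_val_sum big_map zip_map big_map sum_filter_pairs.
have memc p : comm_code p.1 p.2 -> p \in comm_pairs.
  by move=> cp; rewrite mem_filter cp; case: p cp => *; rewrite allpairs_f ?mem_codes.
apply: eq_bigr => h _; apply: eq_bigr => g _.
case: ifP => hg; last first.
  rewrite mxtrace_act_ncomm ?mul0r //; apply: contraFneq hg => gh.
  exact/comm_codeP/esym.
rewrite (cyc_val_mul x8) -(mxtrace_vchar XdX vX (memc (h, g) hg)).
rewrite -(mxtrace_vchar YdY vY (memc (g, h) _)) //.
exact/comm_codeP/esym/comm_codeP.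
Qed.

Lemma twist_codes X d n :
  represents X d -> vdata_twist d n -> twist X = (x ^+ n)%:M.
Proof.
move=> [m [rho [irr XV rhoD]]]; rewrite /vdata_twist.
case E1: (assoc one_code _) => [u|] //; case Ea: (assoc d.1 _) => [v|] //.
move/(cyc_eqP x); rewrite (cyc_val_mul x8) (cyc_val_exp x8).
rewrite -(rhoD _ (assoc_mem E1)) -(rhoD _ (assoc_mem Ea)) /= val_one repr_mx1.
have [s rhoa] : exists s, rho (w d.1) = s%:M.
  apply: irr_central_scalar => //; apply/setIP; split; first exact: cent1id.
  by apply/centP => y /cent1P ay; apply: commute_sym.
have m0 : m%:R != 0 :> C by rewrite pnatr_eq0 -lt0n; case/mx_irrP: irr.
rewrite rhoa !mxtrace_scalar -[s *+ m]mulr_natr => /(mulIf m0) <-.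
exact: (twist_is_V XV rhoa).
Qed.
End Represents.

(** * The modules of the statement *)

Definition exp_code k n := iter n (mul_code k) one_code.

(* The centralizer of a is generated by k, of order m, and rho maps k to
   zeta_m^r. *)
Definition cyclic_data (a k : seq gen) m r : vdata :=
  (of_word a, [seq (exp_code (of_word k) i, cyc_exp (24 %/ m * (r * i) %% 24)) | i <- iota 0 m]).

Definition cyclic_centralizer (a k : seq gen) m :=
  comm_code (of_word a) (of_word k) &&
  all (fun g => comm_code (of_word a) g ==>
                (g \in [seq exp_code (of_word k) i | i <- iota 0 m])) codes.

(** Words for [char_elts], in the same order, with [z] spelled [t1 t1]. *)
Definition class_words : seq (seq gen) :=
  [:: [::]; [:: Gen1; Gen1]; [:: Gen1]; [:: Gen1; Gen3]; [:: Gen1; Gen2]; [:: Gen1; Gen1; Gen1; Gen2];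
      [:: Gen1; Gen2; Gen3]; [:: Gen1; Gen1; Gen1; Gen2; Gen3]].

(** [x^3 + x^-3 = x^3 - x^9 = x + x^3 - x^5], by [x^12 = -1] and [x^8 = x^4 - 1]. *)
Definition sqrt2_cyc : cyc := [:: 0; 1; 0; 1; 0; -1].

Definition int_entries : seq int -> seq entry := map inl.

Definition triv_entries := int_entries [:: 1; 1; 1; 1; 1; 1; 1; 1].
Definition eps_entries  := int_entries [:: 1; 1; -1; 1; 1; 1; -1; -1].
Definition chi2_entries := int_entries [:: 2; 2; 0; 2; -1; -1; 0; 0].
Definition chi3_entries := int_entries [:: 3; 3; 1; -1; 0; 0; -1; -1].
Definition chi3'_entries := int_entries [:: 3; 3; -1; -1; 0; 0; 1; 1].
Definition psi2_entries : seq entry :=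
  int_entries [:: 2; -2; 0; 0; 1; -1] ++ [:: inr true; inr false].
Definition psi2'_entries : seq entry :=
  int_entries [:: 2; -2; 0; 0; 1; -1] ++ [:: inr false; inr true].
Definition psi4_entries := int_entries [:: 4; -4; 0; 0; -1; 1; 0; 0].

Definition central_data (a : seq gen) (chi : seq entry) : vdata :=
  (of_word a, zip [seq of_word s | s <- class_words]
                  [seq cyc_of_entry sqrt2_cyc e | e <- chi]).

Definition data_z := central_data [:: Gen1; Gen1].
Definition data_1 := central_data [::].
Definition data_t1 := cyclic_data [:: Gen1] [:: Gen1] 4.
Definition data_t13 := cyclic_data [:: Gen1; Gen3] [:: Gen1; Gen2; Gen1; Gen3; Gen2] 8.
Definition data_t12 := cyclic_data [:: Gen1; Gen2] [:: Gen1; Gen2] 6.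
Definition data_zt12 := cyclic_data [:: Gen1; Gen1; Gen1; Gen2] [:: Gen1; Gen2] 6.
Definition data_t123 := cyclic_data [:: Gen1; Gen2; Gen3] [:: Gen1; Gen2; Gen3] 8.
Definition data_zt123 := cyclic_data [:: Gen1; Gen1; Gen1; Gen2; Gen3] [:: Gen1; Gen2; Gen3] 8.

Definition data0 : seq vdata :=
  [:: data_z chi3'_entries; data_t12 0; data_z chi2_entries; data_1 triv_entries;
      data_zt123 0; data_t123 6; data_t123 2; data_t13 2; data_z chi3_entries;
      data_z eps_entries; data_t12 4; data_t12 2; data_zt123 4].

Definition data1 : seq vdata :=
  [:: data_t13 1; data_t13 3; data_t1 1; data_1 psi4_entries;
      data_1 psi2_entries; data_1 psi2'_entries; data_t123 5; data_t123 3;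
      data_t123 7; data_t123 1; data_zt12 1; data_zt12 5; data_zt12 3].

(** Exponents of [x = zeta 24] in the twists, that is, in the scalars [rho(a)]: for instance
    [zeta_8^6 = x^18] for [V_t123 6]. *)
Definition twists0 := [:: 0; 0; 0; 0; 0; 18; 6; 12; 0; 0; 16; 8; 12]%N.
Definition twists1 := [:: 18; 6; 6; 0; 0; 0; 15; 9; 21; 3; 16; 8; 0]%N.

Definition fourier_entries : seq (seq entry) :=
  let q : entry := inr true in let q' : entry := inr false in
  let i (n : int) : entry := inl n in
  [:: int_entries [::  3;  3;  6; -6; -3; -3; -3; -3; -3; -3;  0;  0;  0];
      int_entries [::  0;  0;  0; -4;  4;  4;  0;  0;  0;  0;  4;  4; -8];
      int_entries [:: -6; -6;  0; -4; -2; -2;  0;  0;  0;  0;  4;  4;  4];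
      int_entries [::  3;  3;  6;  2;  1;  1;  3;  3;  3;  3;  4;  4;  4];
      [:: q; q'; i 0; i 0; q'; q; q; q; q'; q'; i 0; i 0; i 0];
      [:: q; q'; i 0; i 0; q; q'; q'; q; q'; q; i 0; i 0; i 0];
      [:: q; q'; i 0; i 0; q; q'; q; q'; q; q'; i 0; i 0; i 0];
      int_entries [::  0;  0;  0;  0;  0;  0;  6; -6; -6;  6;  0;  0;  0];
      int_entries [::  3;  3; -6; -6; -3; -3;  3;  3;  3;  3;  0;  0;  0];
      int_entries [:: -3; -3;  6; -2; -1; -1;  3;  3;  3;  3; -4; -4; -4];
      int_entries [::  0;  0;  0; -4;  4;  4;  0;  0;  0;  0;  4; -8;  4];
      int_entries [::  0;  0;  0; -4;  4;  4;  0;  0;  0;  0; -8;  4;  4];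
      [:: q; q'; i 0; i 0; q'; q; q'; q'; q; q; i 0; i 0; i 0]].

Definition fourier_cyc i j :=
  cyc_of_entry (cyc_scale 3 sqrt2_cyc)
    (nth (inl (0 : int)) (nth [::] fourier_entries i) j).

Definition vdata0 : vdata := (one_code, [::]).

Lemma data_valid : all vdata_valid data0 && all vdata_valid data1.
Proof. by vm_compute. Qed.

Lemma data_twists :
  all2 vdata_twist data0 twists0 && all2 vdata_twist data1 twists1.
Proof. by vm_compute. Qed.

(** The S-coefficient should be 24 times the Fourier entry and [fourier_cyc] is 12 times it, whence
    the factor 2. Rows and columns are tabulated once, before the 169 products. *)
Definition S_check :=
  let us := [seq vrow d | d <- data0] in
  let vs := [seq vcol d | d <- data1] in
  all (fun i => all (fun j =>
    cyc_eq (S_dot (nth [::] us i) (nth [::] vs j))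
           (cyc_scale 2 (fourier_cyc i j))) (iota 0 13)) (iota 0 13).

Lemma S_checked : S_check.
Proof. by vm_compute. Qed.

Lemma fourier_rowsE (C : numClosedFieldType) :
  fourier_rows C = [seq [seq entry_val (3 * sqrtC 2) e | e <- r] | r <- fourier_entries].
Proof. reflexivity. Qed.

(** * Roots of unity as powers of a primitive 24-th root *)

Section Roots.
Variables (C : numClosedFieldType) (zeta : nat -> C).
Hypothesis hzeta : root_system zeta.
Let x := zeta 24.

Lemma zeta_exp24 m : (0 < m)%N -> (m %| 24)%N -> zeta m = x ^+ (24 %/ m).
Proof.
move=> m0 dvd; have [_ comp _] := hzeta.
have k0 : (0 < 24 %/ m)%N by rewrite divn_gt0 // dvdn_leq.
have := comp m (24 %/ m)%N m0 k0.
by rewrite [(m * _)%N]mulnC divnK // => ->.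
Qed.

Lemma exp24_12 : x ^+ 12 = -1.
Proof.
have [prim _ _] := hzeta; have p24 := prim 24 isT.
have: (x ^+ 12) ^+ 2 == 1 by rewrite -exprM (prim_expr_order p24).
rewrite sqrf_eq1 => /orP[|/eqP//].
by rewrite -(prim_order_dvd p24).
Qed.

(** [(x^4 + 1)(x^8 - x^4 + 1) = x^12 + 1 = 0], and the first factor is nonzero because [x^8] is not
    1. *)
Lemma exp24_8 : x ^+ 8 = x ^+ 4 - 1.
Proof.
have [prim _ _] := hzeta; have p24 := prim 24 isT.
have x4 : x ^+ 4 + 1 != 0.
  apply/eqP => /eqP; rewrite addr_eq0 => /eqP x4.
  have: x ^+ 8 == 1 by rewrite -[8%N]/(4 * 2)%N exprM x4 sqrrN expr1n.
  by rewrite -(prim_order_dvd p24).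
apply/subr0_eq/(mulfI x4); rewrite mulr0.
transitivity (x ^+ 12 + 1); first by ring.
by rewrite exp24_12 addNr.
Qed.

Lemma sqrt2_cycE : cyc_val x sqrt2_cyc = sqrtC 2.
Proof.
(* The last clause of [root_system] fixes the sign of the square root. *)
have [_ _ <-] := hzeta; rewrite (zeta_exp24 (m := 8)) //=.
have -> : (x ^+ 3)^-1 = - (x ^+ 9).
  by apply: mulr1_eq; rewrite mulrN -exprD exp24_12 opprK.
by rewrite exprS exp24_8 /sqrt2_cyc /cyc_val /=; ring.
Qed.
End Roots.

Lemma zip_maps (S T S' T' : Type) (f : S -> S') (g : T -> T') s t :
  zip [seq f a | a <- s] [seq g b | b <- t] = [seq (f p.1, g p.2) | p <- zip s t].
Proof. by elim: s t => [|a s IHs] [|b t] //=; rewrite IHs. Qed.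

(** * From labels to finite data *)

Section Labels.
Variables (C : numClosedFieldType) (zeta : nat -> C).
Hypothesis hzeta : root_system zeta.
Variables (gT : finGroupType) (z t1 t2 t3 : gT).
Hypothesis hG : binary_octahedral z t1 t2 t3.
Notation x := (zeta 24).
Notation w := (val_code t1 t2 t3).
Notation wv := (word_val t1 t2 t3).

Lemma val_exp_code k n : w (exp_code k n) = (w k ^+ n)%g.
Proof.
elim: n => [|n IHn]; first exact: val_one.
by rewrite /exp_code iterS (val_mul_code hG) IHn expgS.
Qed.

(** The centralizer consists of powers of [k], hence is abelian; so [rho] has degree 1 and its value
    at [k] determines all the others. *)
Lemma represents_cyclic X a k m r g h :
  has_label X (Label g [:: (h, zeta m ^+ r)]) -> g = wv a -> h = wv k ->
  (0 < m)%N -> (m %| 24)%N -> cyclic_centralizer a k m ->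
  represents t1 t2 t3 x X (cyclic_data a k m r).
Proof.
rewrite -!(val_of_word hG) => -[d [rho [/= irr rhoh XV]]] Eg Eh m0 dvd.
subst g h => /andP[ak /allP cent].
have Ck : w (of_word k) \in 'C[w (of_word a)]%G.
  exact/cent1P/commute_sym/(comm_codeP hG).
have cyc y : y \in 'C[w (of_word a)]%G -> exists i, y = (w (of_word k) ^+ i)%g.
  have [w' w'K wK] := val_code_bij hG.
  move=> /cent1P; rewrite -(wK y) => /commute_sym/(comm_codeP hG) ay.
  have := cent (w' y) (mem_codes _); rewrite ay => /mapP[i _ ->].
  by exists i; rewrite val_exp_code.
have abC : abelian 'C[w (of_word a)]%G.
  apply/centsP => y /cyc[i ->] y' /cyc[j ->].
  exact/commuteX2.
have d1 := irr_abelian_linear irr abC; subst d.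
exists 1%N, rho; split=> // _ /mapP[i _ ->] /=.
rewrite (cyc_val_exp (exp24_8 hzeta)) val_exp_code repr_mxX //.
have /eqP := rhoh _ (mem_head _ _); rewrite /= [rho _]mx11_scalar mxtrace_scalar.
rewrite mulr1n => /eqP ->.
(* The exponents in [cyclic_data] are reduced modulo 24, the order of [x]. *)
have [prim _ _] := hzeta; rewrite expr_mod ?(prim_expr_order (prim 24 isT)) //.
by rewrite -rmorphXn mxtrace_scalar mulr1n (zeta_exp24 hzeta) // -!exprM mulnA.
Qed.

Lemma represents_central X a chi vals :
  has_label X (Label (wv a) (zip (char_elts z t1 t2 t3) vals)) ->
  vals = [seq entry_val (sqrtC 2) e | e <- chi] ->
  represents t1 t2 t3 x X (central_data a chi).
Proof.
move=> [d [rho [/= irr rhov XV]]] Ev; subst vals.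
have ce : char_elts z t1 t2 t3 = [seq w c | c <- [seq of_word s | s <- class_words]].
  rewrite -map_comp /=; have zt := gen_val_sqr hG Gen1.
  by rewrite !(val_of_word hG) /word_val !big_cons !big_nil /= !mulg1 /char_elts -zt -!mulgA.
rewrite -(val_of_word hG) in rho irr rhov XV.
exists d, rho; split=> // p pD; apply: (rhov (w p.1, cyc_val x p.2)).
rewrite ce -(sqrt2_cycE hzeta) -(eq_map (cyc_val_entry x sqrt2_cyc)).
rewrite (map_comp (cyc_val x)) zip_maps.
exact: (map_f (fun p => (w p.1, cyc_val x p.2)) pD).
Qed.

Let val_z : z = wv [:: Gen1; Gen1].
Proof. by rewrite /word_val !big_cons big_nil mulg1 (gen_val_sqr hG Gen1). Qed.

Lemma represents_z X chi vals :
  has_label X (V_z z t1 t2 t3 vals) ->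
  vals = [seq entry_val (sqrtC 2) e | e <- chi] ->
  represents t1 t2 t3 x X (data_z chi).
Proof. by rewrite /V_z {1}val_z; apply: represents_central. Qed.

Lemma represents_1 X chi vals :
  has_label X (V_1 z t1 t2 t3 vals) ->
  vals = [seq entry_val (sqrtC 2) e | e <- chi] ->
  represents t1 t2 t3 x X (data_1 chi).
Proof.
rewrite /V_1 (_ : 1%g = wv [::]); last by rewrite /word_val big_nil.
exact: represents_central.
Qed.

Lemma represents_t1 X r :
  has_label X (V_t1 t1 zeta r) -> represents t1 t2 t3 x X (data_t1 r).
Proof.
move=> lab; apply: (represents_cyclic lab); last by vm_compute.
all: by rewrite /word_val ?(big_cons, big_nil, mulg1, mulgA).
Qed.

Lemma represents_t13 X r :
  has_label X (V_t13 t1 t2 t3 zeta r) -> represents t1 t2 t3 x X (data_t13 r).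
Proof.
move=> lab; apply: (represents_cyclic lab); last by vm_compute.
all: by rewrite /word_val ?(big_cons, big_nil, mulg1, mulgA).
Qed.

Lemma represents_t12 X r :
  has_label X (V_t12 t1 t2 zeta r) -> represents t1 t2 t3 x X (data_t12 r).
Proof.
move=> lab; apply: (represents_cyclic lab); last by vm_compute.
all: by rewrite /word_val ?(big_cons, big_nil, mulg1, mulgA).
Qed.

Lemma represents_zt12 X r :
  has_label X (V_zt12 z t1 t2 zeta r) -> represents t1 t2 t3 x X (data_zt12 r).
Proof.
move=> lab; apply: (represents_cyclic lab); last by vm_compute.
all: by rewrite ?val_z /word_val ?(big_cons, big_nil, mulg1, mulgA).
Qed.

Lemma represents_t123 X r :
  has_label X (V_t123 t1 t2 t3 zeta r) -> represents t1 t2 t3 x X (data_t123 r).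
Proof.
move=> lab; apply: (represents_cyclic lab); last by vm_compute.
all: by rewrite /word_val ?(big_cons, big_nil, mulg1, mulgA).
Qed.

Lemma represents_zt123 X r :
  has_label X (V_zt123 z t1 t2 t3 zeta r) -> represents t1 t2 t3 x X (data_zt123 r).
Proof.
move=> lab; apply: (represents_cyclic lab); last by vm_compute.
all: by rewrite ?val_z /word_val ?(big_cons, big_nil, mulg1, mulgA).
Qed.

Lemma represents_degree0 (X : 'I_13 -> dd_module C gT) i :
  has_label (X i) (tnth (degree0 z t1 t2 t3 zeta) i) ->
  represents t1 t2 t3 x (X i) (nth vdata0 data0 i).
Proof.
rewrite (tnth_nth (V_1 z t1 t2 t3 (triv C))); case: i.
case=> [|[|[|[|[|[|[|[|[|[|[|[|[|i]]]]]]]]]]]]] i13 lab //.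
- exact: represents_z lab _.
- exact: represents_t12 lab.
- exact: represents_z lab _.
- exact: represents_1 lab _.
- exact: represents_zt123 lab.
- exact: represents_t123 lab.
- exact: represents_t123 lab.
- exact: represents_t13 lab.
- exact: represents_z lab _.
- exact: represents_z lab _.
- exact: represents_t12 lab.
- exact: represents_t12 lab.
- exact: represents_zt123 lab.
Qed.

Lemma represents_degree1 (Y : 'I_13 -> dd_module C gT) i :
  has_label (Y i) (tnth (degree1 z t1 t2 t3 zeta) i) ->
  represents t1 t2 t3 x (Y i) (nth vdata0 data1 i).
Proof.
rewrite (tnth_nth (V_1 z t1 t2 t3 (triv C))); case: i.
case=> [|[|[|[|[|[|[|[|[|[|[|[|[|i]]]]]]]]]]]]] i13 lab //.
- exact: represents_t13 lab.
- exact: represents_t13 lab.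
- exact: represents_t1 lab.
- exact: represents_1 lab _.
- exact: represents_1 lab _.
- exact: represents_1 lab _.
- exact: represents_t123 lab.
- exact: represents_t123 lab.
- exact: represents_t123 lab.
- exact: represents_t123 lab.
- exact: represents_zt12 lab.
- exact: represents_zt12 lab.
- exact: represents_zt12 lab.
Qed.
End Labels.

(** * The Fourier matrix *)

(** The proposed matrix is a right inverse of the square, which makes the square a unit and
    identifies its inverse. *)
Lemma diag_mx_expN2 (F : fieldType) n (d : 'rV[F]_n.+1) :
  (forall i, d 0 i != 0) ->
  (diag_mx d) ^- 2 = diag_mx (\row_i (d 0 i) ^- 2).
Proof.
move=> d0; set e := diag_mx (\row_i _).
have de : diag_mx d ^+ 2 * e = 1.
  rewrite expr2 -!mulmxE !mulmx_diag -[RHS]diag_const_mx.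
  congr diag_mx; apply/rowP => i; rewrite !mxE -expr2 mulfV //.
  by rewrite expf_neq0.
have Ud : diag_mx d ^+ 2 \is a GRing.unit.
  by have /mulmx1_unit[] : (diag_mx d ^+ 2) *m e = 1%:M by rewrite mulmxE de.
by rewrite -[LHS]mulr1 -de mulKr.
Qed.

Lemma all2_nth (S T : Type) (r : S -> T -> bool) x0 y0 s t i :
  all2 r s t -> (i < size s)%N -> r (nth x0 s i) (nth y0 t i).
Proof. by elim: s t i => [|a s IHs] [|b t] [|i] //= /andP[rab rst]; auto. Qed.

Lemma data0_valid (i : 'I_13) : vdata_valid (nth vdata0 data0 i).
Proof. by case/andP: data_valid => /(all_nthP vdata0)/(_ i (ltn_ord i)). Qed.

Lemma data1_valid (i : 'I_13) : vdata_valid (nth vdata0 data1 i).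
Proof. by case/andP: data_valid => _ /(all_nthP vdata0)/(_ i (ltn_ord i)). Qed.

Lemma data0_twist (i : 'I_13) :
  vdata_twist (nth vdata0 data0 i) (nth 0%N twists0 i).
Proof.
case/andP: data_twists => tw _.
exact: (all2_nth vdata0 0%N tw (ltn_ord i : (i < size data0)%N)).
Qed.

Lemma data1_twist (i : 'I_13) :
  vdata_twist (nth vdata0 data1 i) (nth 0%N twists1 i).
Proof.
case/andP: data_twists => _ tw.
exact: (all2_nth vdata0 0%N tw (ltn_ord i : (i < size data1)%N)).
Qed.

Lemma S_checked_at (i j : 'I_13) :
  cyc_eq (S_dot (vrow (nth vdata0 data0 i)) (vcol (nth vdata0 data1 j)))
         (cyc_scale 2 (fourier_cyc i j)).
Proof.
have mem13 (k : 'I_13) : (k : nat) \in iota 0 13 by rewrite mem_iota ltn_ord.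
rewrite -(nth_map vdata0 [::] vrow (ltn_ord i : (i < size data0)%N)).
rewrite -(nth_map vdata0 [::] vcol (ltn_ord j : (j < size data1)%N)).
exact: (allP (allP S_checked i (mem13 i)) j (mem13 j)).
Qed.

Section Main.
Variables (C : numClosedFieldType) (zeta : nat -> C).
Hypothesis hzeta : root_system zeta.
Notation x := (zeta 24).

Lemma fourier_matrixE i j :
  fourier_matrix C i j = 12^-1 * cyc_val x (fourier_cyc i j).
Proof.
rewrite !mxE fourier_rowsE; congr (_ * _).
rewrite /fourier_cyc cyc_val_entry cyc_val_scale (sqrt2_cycE hzeta).
have s13 : size fourier_entries = 13%N by [].
have r13 : all (fun r => size r == 13%N) fourier_entries by [].
rewrite (nth_map [::]) ?s13 // (nth_map (inl (0 : int))) //.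
by rewrite (eqP (all_nthP [::] r13 _ _)) ?s13.
Qed.

Lemma fourier_F1E :
  fourier_F1 zeta = diag_mx (\row_(i < 13) (x ^+ nth 0%N twists0 i)^-1).
Proof.
have [prim _ _] := hzeta; have x24 := prim_expr_order (prim 24 isT).
(* Turns the inverse twists into the positive powers of [x] found in [fourier_F1]. *)
have inv m n : (m + n = 24)%N -> x ^+ n = (x ^+ m)^-1.
  by move=> mn; apply/esym/mulr1_eq; rewrite -exprD mn.
have x12 := exp24_12 hzeta.
rewrite /fourier_F1 (zeta_exp24 hzeta (m := 4)) // (zeta_exp24 hzeta (m := 3)) //.
congr diag_mx; apply/rowP; case.
case=> [|[|[|[|[|[|[|[|[|[|[|[|[|i]]]]]]]]]]]]] i13 //;
  rewrite !mxE /= -?exprM ?invr1 //.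
- exact: inv.
- by rewrite -(inv 6 18)%N // -[18%N]/(12 + 6)%N exprD x12 mulN1r.
- by rewrite x12 invrN1.
- exact: inv.
- exact: inv.
- by rewrite x12 invrN1.
Qed.

(** The entries of [T1] are inverse twists [x^-n], so those of [- T1 ^- 2] are [- x^(2n)]; what
    remains is reduction by [x^24 = 1] and [x^12 = -1]. *)
Lemma fourier_F2E :
  fourier_F2 zeta =
  - diag_mx (\row_(i < 13) (x ^+ nth 0%N twists1 i)^-1) ^- 2.
Proof.
have [prim _ _] := hzeta; have x24 := prim_expr_order (prim 24 isT).
have x0 n : x ^+ n != 0.
  by apply: expf_neq0; apply/eqP => x0; move/eqP: x24; rewrite x0 expr0n eq_sym oner_eq0.
rewrite diag_mx_expN2 => [|i]; last by rewrite mxE invr_neq0.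
rewrite -raddfN /=.
have x12 := exp24_12 hzeta.
rewrite /fourier_F2 (zeta_exp24 hzeta (m := 4)) // (zeta_exp24 hzeta (m := 3)) //.
have mod24 n : x ^+ (24 + n) = x ^+ n by rewrite exprD x24 mul1r.
have mod12 n : x ^+ (12 + n) = - x ^+ n by rewrite exprD x12 mulN1r.
congr diag_mx; apply/rowP; case.
case=> [|[|[|[|[|[|[|[|[|[|[|[|[|i]]]]]]]]]]]]] i13 //;
  rewrite !mxE /= exprVn invrK -?exprM.
- by rewrite -[(18 * 2)%N]/(24 + 12)%N mod24 x12 opprK.
- by rewrite -[(6 * 2)%N]/12%N x12 opprK.
- by rewrite -[(6 * 2)%N]/12%N x12 opprK.
- by [].
- by [].
- by [].
- by rewrite -[(15 * 2)%N]/(24 + 6)%N mod24.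
- by rewrite -[(9 * 2)%N]/(12 + 6)%N mod12 opprK.
- by rewrite -[(21 * 2)%N]/(24 + (12 + 6))%N mod24 mod12 opprK.
- by [].
- by rewrite -[(16 * 2)%N]/(24 + 8)%N mod24.
- by [].
- by [].
Qed.

Lemma binary_octahedral_fourier
    (gT : finGroupType) (z t1 t2 t3 : gT)
    (X Y : 'I_13 -> dd_module C gT)
    (hG : binary_octahedral z t1 t2 t3)
    (hX : forall i, has_label (X i) (tnth (degree0 z t1 t2 t3 zeta) i))
    (hY : forall i, has_label (Y i) (tnth (degree1 z t1 t2 t3 zeta) i)) :
  exists T0 T1 : 'M[C]_13,
    [/\ is_inv_twist_matrix X T0,
        is_inv_twist_matrix Y T1,
        24^-1 *: S_matrix X Y = fourier_matrix C,
        fourier_F1 zeta = T0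
      & fourier_F2 zeta = - T1 ^- 2].
Proof.
have repX i := represents_degree0 hzeta hG (hX i).
have repY i := represents_degree1 hzeta hG (hY i).
have x8 := exp24_8 hzeta.
exists (diag_mx (\row_(i < 13) (x ^+ nth 0%N twists0 i)^-1)).
exists (diag_mx (\row_(i < 13) (x ^+ nth 0%N twists1 i)^-1)).
split; last 2 first.
- exact: fourier_F1E.
- exact: fourier_F2E.
- exists (fun i : 'I_13 => x ^+ nth 0%N twists0 i); split=> [i|]; last by [].
  exact: (twist_codes x8 (repX i) (data0_twist i)).
- exists (fun i : 'I_13 => x ^+ nth 0%N twists1 i); split=> [i|]; last by [].
  exact: (twist_codes x8 (repY i) (data1_twist i)).
apply/matrixP => i j; rewrite fourier_matrixE mxE mxE.
rewrite (S_coef_codes hG x8 (repX i) (repY j) (data0_valid i) (data1_valid j)).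
rewrite (cyc_eqP x (S_checked_at i j)).
(* The 2 in [24 = 12 * 2] cancels the factor 2 of [S_check]. *)
rewrite cyc_val_scale -[24%N]/(12 * 2)%N natrM invfM -mulrA; congr (_ * _).
by rewrite mulKf // pnatr_eq0.
Qed.
End Main.

Theorem theorem4p5 (R : realType) (zeta : nat -> R[i])
    (gT : finGroupType) (z t1 t2 t3 : gT)
    (X Y : 'I_13 -> dd_module (R[i] : numClosedFieldType) gT)
    (hzeta : root_system zeta)
    (hG : binary_octahedral z t1 t2 t3)
    (hX : forall i, has_label (X i) (tnth (degree0 z t1 t2 t3 zeta) i))
    (hY : forall i, has_label (Y i) (tnth (degree1 z t1 t2 t3 zeta) i)) :
  exists T0 T1 : 'M[R[i]]_13,
    [/\ is_inv_twist_matrix X T0,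
        is_inv_twist_matrix Y T1,
        24^-1 *: S_matrix X Y = fourier_matrix (R[i] : numClosedFieldType),
        fourier_F1 zeta = T0
      & fourier_F2 zeta = - T1 ^- 2].
Proof.
exact: (binary_octahedral_fourier hzeta hG hX hY).
Qed.
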